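(* Let $L$ be a completely distributive lattice, let $L^{L}$ be the complete lattice of all order-preserving maps $L\to L$ with the pointwise order, and for $f,g\in L^{L}$ define $(g\bullet f)(a)=\bigwedge\{c\in L\mid \exists b\in L:\ b\triangleleft^{co} f(a)\text{ and } c\triangleleft^{co} g(b)\}$ for all $a\in L$, where $\triangleleft^{co}$ is the co-wedge-below relation. Then $(L^{L},\bullet)$ is a co-quantale.
   Context: In a complete lattice $P$, $x\triangleleft y$ means that for every subset $A\subseteq P$ (possibly empty) with $y\leq\bigvee A$ there is $a\in A$ with $x\leq a$; $x\triangleleft^{co}y$ ($x$ is co-wedge-below $y$) means that for every subset $A\subseteq P$ (possibly empty) with $\bigwedge A\leq y$ there is $a\in A$ with $a\leq x$. A complete lattice $L$ is completely distributive if $x=\bigvee\{y\in L\mid y\triangleleft x\}$ for all $x\in L$. A co-quantale is a complete lattice $Q$ with an associative binary operation $\ast$ such that $a\ast(\bigwedge_{i\in I}b_i)=\bigwedge_{i\in I}(a\ast b_i)$ and $(\bigwedge_{i\in I}b_i)\ast a=\bigwedge_{i\in I}(b_i\ast a)$ for all $a\in Q$ and all families $\{b_i\}_{i\in I}\subseteq Q$ (including the empty family). *)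

(* Defs.v *)
From HB Require Import structures.
From mathcomp Require Import all_boot all_order.
From mathcomp Require Import boolp classical_sets.

Set Implicit Arguments.
Unset Strict Implicit.
Unset Printing Implicit Defensive.

Import Order.TTheory.
Local Open Scope classical_set_scope.
Local Open Scope order_scope.

(* [supremums A x] (resp. [infimums A x]) says that x is the least upper bound
   (resp. greatest lower bound) of A; A may be empty. *)
HB.mixin Record POrder_isCompleteLattice d T of Order.POrder d T := {
  join_set : set T -> T;
  meet_set : set T -> T;
  join_setP : forall A : set T, supremums A (join_set A);
  meet_setP : forall A : set T, infimums A (meet_set A)
}.

#[short(type="completeLatticeType")]
HB.structure Definition CompleteLattice d :=
  {T of Order.POrder d T & POrder_isCompleteLattice d T}.

Definition wedge_below d (P : completeLatticeType d) (x y : P) : Prop :=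
  forall A : set P, y <= join_set A -> exists2 a, A a & x <= a.

Definition cowedge_below d (P : completeLatticeType d) (x y : P) : Prop :=
  forall A : set P, meet_set A <= y -> exists2 a, A a & a <= x.

Definition completely_distributive d (L : completeLatticeType d) : Prop :=
  forall x : L, x = join_set [set y | wedge_below y x].

(* No unit is required; the index type I may be empty. *)
Record is_coquantale d (Q : completeLatticeType d) (op : Q -> Q -> Q) : Prop :=
  IsCoquantale {
    coquantale_opA : associative op;
    coquantale_op_meetr : forall (a : Q) (I : Type) (b : I -> Q),
      op a (meet_set (range b)) = meet_set (range (fun i => op a (b i)));
    coquantale_op_meetl : forall (a : Q) (I : Type) (b : I -> Q),
      op (meet_set (range b)) a = meet_set (range (fun i => op (b i) a))
  }.

Section OrderMorphismCompleteLattice.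
Context {d d' : Order.disp_t} {T : porderType d} {L : completeLatticeType d'}.
Implicit Types (f g h : {omorphism T -> L}) (F : set {omorphism T -> L}).

HB.instance Definition _ := gen_eqMixin {omorphism T -> L}.
HB.instance Definition _ := gen_choiceMixin {omorphism T -> L}.

Lemma omorphism_eqP f g : f =1 g -> f = g.
Proof.
case: f g => [f [[fP]]] [g [[gP]]] /= /funext fg.
by case: _ / fg gP => gP; rewrite (Prop_irrelevance fP gP).
Qed.

Definition le_omorphism f g : bool := `[< forall x, f x <= g x >].

Fact le_omorphism_refl : reflexive le_omorphism.
Proof. by move=> f; apply/asboolP => x. Qed.

Fact le_omorphism_anti : antisymmetric le_omorphism.
Proof.
move=> f g /andP[/asboolP fg /asboolP gf]; apply: omorphism_eqP => x.
by apply/le_anti; rewrite fg gf.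
Qed.

Fact le_omorphism_trans : transitive le_omorphism.
Proof.
move=> g f h /asboolP fg /asboolP gh; apply/asboolP => x.
exact: le_trans (fg x) (gh x).
Qed.

HB.instance Definition _ := Order.Le_isPOrder.Build FunOrder.fun_display
  {omorphism T -> L} le_omorphism_refl le_omorphism_anti le_omorphism_trans.

Lemma le_omorphismP f g : reflect (forall x, f x <= g x) (f <= g).
Proof. exact: asboolP. Qed.

Definition join_fun F (x : T) : L := join_set [set f x | f in F].
Definition meet_fun F (x : T) : L := meet_set [set f x | f in F].

Fact join_fun_homo F : {homo join_fun F : x y / x <= y}.
Proof.
move=> x y xy; apply: (join_setP _).2 => _ [f Ff <-].
apply: le_trans (omorph_le f xy) _.
by apply: (join_setP _).1; exists f.
Qed.

Fact meet_fun_homo F : {homo meet_fun F : x y / x <= y}.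
Proof.
move=> x y xy; apply: (meet_setP _).2 => _ [f Ff <-].
apply: le_trans (omorph_le f xy).
by apply: (meet_setP _).1; exists f.
Qed.

HB.instance Definition _ F :=
  Order.isOrderMorphism.Build d T d' L (join_fun F) (@join_fun_homo F).
HB.instance Definition _ F :=
  Order.isOrderMorphism.Build d T d' L (meet_fun F) (@meet_fun_homo F).

Definition join_omorphism F : {omorphism T -> L} := join_fun F.
Definition meet_omorphism F : {omorphism T -> L} := meet_fun F.

Fact join_omorphismP F : supremums F (join_omorphism F).
Proof.
split=> [f Ff|g gF]; apply/le_omorphismP => x.
  by apply: (join_setP _).1; exists f.
by apply: (join_setP _).2 => _ [f Ff <-]; exact: (le_omorphismP _ _ (gF f Ff)).
Qed.

Fact meet_omorphismP F : infimums F (meet_omorphism F).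
Proof.
split=> [f Ff|g gF]; apply/le_omorphismP => x.
  by apply: (meet_setP _).1; exists f.
by apply: (meet_setP _).2 => _ [f Ff <-]; exact: (le_omorphismP _ _ (gF f Ff)).
Qed.

HB.instance Definition _ := POrder_isCompleteLattice.Build
  FunOrder.fun_display {omorphism T -> L} join_omorphismP meet_omorphismP.

End OrderMorphismCompleteLattice.

Section Bullet.
Context {d : Order.disp_t} {L : completeLatticeType d}.
Implicit Types f g : {omorphism L -> L}.

Definition bullet_fun g f (a : L) : L :=
  meet_set [set c | exists b, cowedge_below b (f a) /\ cowedge_below c (g b)].

Fact bullet_fun_homo g f : {homo bullet_fun g f : x y / x <= y}.
Proof.
move=> x y xy; apply: (meet_setP _).2 => c [b [bfy cgb]].
apply: (meet_setP _).1; exists b; split=> // A Afx.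
exact: bfy (le_trans Afx (omorph_le f xy)).
Qed.

HB.instance Definition _ g f :=
  Order.isOrderMorphism.Build d L d L (bullet_fun g f) (@bullet_fun_homo g f).

Definition bullet g f : {omorphism L -> L} := bullet_fun g f.

End Bullet.

(* Main.v *)
Require Import Defs.
From mathcomp Require Import all_boot all_order.
From mathcomp Require Import boolp classical_sets.

(** Complete distributivity is self-dual, so every element is the meet of the
    elements co-wedge-below it.  Consequently [b] is co-wedge-below a meet iff
    it is co-wedge-below one of the members, and [z <= (g . f) a] holds iff
    [z <= g b] for all [b] co-wedge-below [f a].  With these two equivalences,
    both sides of each co-quantale law have the same lower bounds. *)

Import Order.TTheory.
Local Open Scope classical_set_scope.
Local Open Scope order_scope.

Section CompleteLattice.
Context {d : Order.disp_t} {L : completeLatticeType d}.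
Implicit Types (x y z b : L) (A : set L).

Lemma le_meet_set z A : z <= meet_set A <-> forall x, A x -> z <= x.
Proof.
have [lbA glbA] := meet_setP A; split=> [zA x Ax|]; last exact: glbA.
exact: le_trans zA (lbA x Ax).
Qed.

Lemma meet_set_le A x : A x -> meet_set A <= x.
Proof. exact: (meet_setP A).1. Qed.

Lemma eq_lower_bounds x y : (forall z, z <= x <-> z <= y) -> x = y.
Proof. by move=> xy; apply/le_anti/andP; split; apply/xy. Qed.

Lemma cowedge_le b x : cowedge_below b x -> x <= b.
Proof.
by case/(_ [set x]) => [|y ->//]; apply: meet_set_le.
Qed.

Lemma cowedge_le_trans b x y : x <= y -> cowedge_below b y -> cowedge_below b x.
Proof. by move=> xy b_y A Ax; exact: b_y (le_trans Ax xy). Qed.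

Lemma le_cowedge_trans z b x :
  z <= b -> cowedge_below z x -> cowedge_below b x.
Proof.
by move=> zb z_x A /z_x[a Aa az]; exists a => //; exact: le_trans az zb.
Qed.

End CompleteLattice.

Section CompletelyDistributive.
Context {d : Order.disp_t} {L : completeLatticeType d}.
Hypothesis L_cd : completely_distributive L.
Implicit Types (x y z b c : L) (A : set L) (f g h : {omorphism L -> L}).

(* If [z] is wedge-below the meet on the right but not below [x], then the join
   of all [u] with [~ z <= u] is co-wedge-below [x], so it lies above that meet;
   hence [z <= u] for one of these [u]. *)
Lemma completely_distributive_cowedge x :
  x = meet_set [set y | cowedge_below y x].
Proof.
apply/le_anti/andP; split; first by apply/le_meet_set => y /cowedge_le.
rewrite [leLHS]L_cd; apply: (join_setP _).2 => z /= z_m.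
apply: contrapT => nzx; pose U := [set u : L | ~ z <= u].
have Ux : cowedge_below (join_set U) x.
  move=> A Ax; apply: contrapT => nA; apply: nzx.
  apply: le_trans Ax; apply/le_meet_set => a Aa.
  apply: contrapT => nza; apply: nA; exists a => //.
  exact: (join_setP U).1.
by have [u nzu zu] := z_m U (meet_set_le [set y | cowedge_below y x] _ Ux).
Qed.

(** Each member of [A] is the meet of the elements co-wedge-below it, so all these elements together
    have a meet below [meet_set A]. Hence [b] lies above one of them. *)
Lemma cowedge_meet_set b A :
  cowedge_below b (meet_set A) <-> exists2 x, A x & cowedge_below b x.
Proof.
split=> [bA|[x Ax]]; last exact/cowedge_le_trans/meet_set_le.
have [|c [x Ax c_x] cb] := bA [set c | exists2 x, A x & cowedge_below c x].
  apply/le_meet_set => x Ax; rewrite [leRHS]completely_distributive_cowedge.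
  by apply/le_meet_set => c c_x; apply: meet_set_le; exists x.
by exists x => //; exact: le_cowedge_trans cb c_x.
Qed.

(** Apply [cowedge_meet_set] to [x] written as the meet of the elements co-wedge-below it. *)
Lemma cowedge_interpolation b x :
  cowedge_below b x -> exists2 c, cowedge_below c x & cowedge_below b c.
Proof.
by rewrite {1}(completely_distributive_cowedge x) => /cowedge_meet_set.
Qed.

(** For fixed [b], the elements [c] in the definition of [bullet] have meet [g b]. *)
Lemma le_bullet z g f x :
  z <= bullet g f x <-> forall b, cowedge_below b (f x) -> z <= g b.
Proof.
split=> [/le_meet_set zgf b bfx | zgf].
  rewrite [leRHS]completely_distributive_cowedge; apply/le_meet_set => c cgb.
  by apply: zgf; exists b.
by apply/le_meet_set => c [b [/zgf zgb /cowedge_le]]; exact: le_trans.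
Qed.

Lemma cowedge_bullet c g f x : cowedge_below c (bullet g f x) <->
  exists2 b, cowedge_below b (f x) & cowedge_below c (g b).
Proof.
split=> [/cowedge_meet_set[e [b [bfx egb] /cowedge_le ec]]|[b bfx]].
  by exists b => //; exact: le_cowedge_trans ec egb.
(* The interpolant [e] belongs to the set whose meet defines [bullet], and [c] is co-wedge-below
   it. *)
move=> /cowedge_interpolation[e egb ce].
by apply/cowedge_meet_set; exists e => //; exists b.
Qed.

(** Meets of maps are pointwise by definition, so the left side unfolds to a meet of the values
    [f i x]. *)
Lemma le_meet_range_omorphism z I (f : I -> {omorphism L -> L}) x :
  z <= (meet_set (range f) : {omorphism L -> L}) x <-> forall i, z <= f i x.
Proof.
split=> [/le_meet_set zf i|zf]; first by apply: zf; exists (f i) => //; exists i.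
by apply/le_meet_set => _ [_ [i _ <-] <-].
Qed.

Lemma cowedge_meet_range_omorphism b I (f : I -> {omorphism L -> L}) x :
  cowedge_below b ((meet_set (range f) : {omorphism L -> L}) x) <->
  exists i, cowedge_below b (f i x).
Proof.
split=> [/cowedge_meet_set[_ [_ [i _ <-] <-] bfi]|[i bfi]]; first by exists i.
by apply/cowedge_meet_set; exists (f i x) => //; exists (f i) => //; exists i.
Qed.

(** At [x], the lower bounds of either side are the [z] with [z <= h c] whenever [c] is
    co-wedge-below [g b] for some [b] co-wedge-below [f x]. *)
Lemma bulletA : associative (@bullet d L).
Proof.
move=> h g f; apply: omorphism_eqP => x; apply: eq_lower_bounds => z.
split=> /le_bullet zhgf; apply/le_bullet.
  move=> b bfx; apply/le_bullet => c cgb.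
  by apply: zhgf; apply/cowedge_bullet; exists b.
by move=> c /cowedge_bullet[b /zhgf/le_bullet]; exact.
Qed.

Lemma bullet_meetr g I (f : I -> {omorphism L -> L}) :
  bullet g (meet_set (range f)) = meet_set (range (fun i => bullet g (f i))).
Proof.
apply: omorphism_eqP => x; apply: eq_lower_bounds => z; split.
  move=> /le_bullet zgf; apply/le_meet_range_omorphism => i.
  apply/le_bullet => b bfi; apply: zgf.
  by apply/cowedge_meet_range_omorphism; exists i.
move=> /le_meet_range_omorphism zgf; apply/le_bullet => b.
by case/cowedge_meet_range_omorphism => i; move: b; apply/le_bullet/zgf.
Qed.

(** Both sides ask for [z <= g i b] for all [i] and all [b] co-wedge-below [f x]; only the order of
    the quantifiers differs. *)
Lemma bullet_meetl f I (g : I -> {omorphism L -> L}) :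
  bullet (meet_set (range g)) f = meet_set (range (fun i => bullet (g i) f)).
Proof.
apply: omorphism_eqP => x; apply: eq_lower_bounds => z; split.
  move=> /le_bullet zgf; apply/le_meet_range_omorphism => i.
  by apply/le_bullet => b /zgf/le_meet_range_omorphism.
move=> /le_meet_range_omorphism zgf; apply/le_bullet => b bfx.
by apply/le_meet_range_omorphism => i; move: b bfx; apply/le_bullet/zgf.
Qed.

End CompletelyDistributive.

Theorem theorem4p8 (d : Order.disp_t) (L : completeLatticeType d)
    (L_cd : completely_distributive L) :
  is_coquantale (Q := {omorphism L -> L}) bullet.
Proof.
split.
- exact: bulletA.
- by move=> g I f; exact: bullet_meetr.
- by move=> f I g; exact: bullet_meetl.
Qed.
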